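(* The number of admissible line complexes in $\mathbb{Z}_2^4$ consisting of exactly $16$ lines is $984014621487058560$.
   Context: An affine line in $\mathbb{Z}_2^4$ is a set $\{x, x+v\}$ with $x \in \mathbb{Z}_2^4$ and $v \in \mathbb{Z}_2^4 \setminus \{0\}$; thus lines are exactly the $120$ unordered pairs of distinct points of $\mathbb{Z}_2^4$. A line complex is a subset $\mathcal{C}$ of the set of all lines. For $f \colon \mathbb{Z}_2^4 \to \mathbb{C}$ and a line $L$, $Rf(L) = \sum_{x \in L} f(x)$, and $R_{\mathcal{C}} f = (Rf(L))_{L \in \mathcal{C}}$. The complex $\mathcal{C}$ is admissible if the linear map $R_{\mathcal{C}} \colon \mathbb{C}^{\mathbb{Z}_2^4} \to \mathbb{C}^{\mathcal{C}}$ is injective. Complexes are counted as subsets of the set of all lines (points are labeled; no identification up to symmetry). *)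

(* Defs.v *)
From HB Require Import structures.
From mathcomp Require Import all_boot all_order all_algebra.
From mathcomp Require Import boolp reals complex.

Set Implicit Arguments.
Unset Strict Implicit.
Unset Printing Implicit Defensive.

Import GRing.Theory.
Local Open Scope ring_scope.

Notation point := 'rV['Z_2]_4.

Definition lines : {set {set point}} :=
  [set [set x; x + v] | x in [set: point], v in [set w : point | w != 0]].

Definition line_complex (C : {set {set point}}) : bool := C \subset lines.

(* For R : realType, R[i] is the field of complex numbers. *)
Definition radon (R : realType) (f : {ffun point -> R[i]}) (L : {set point}) :
  R[i] := \sum_(x in L) f x.

Definition radon_restr (R : realType) (C : {set {set point}})
    (f : {ffun point -> R[i]}) : {ffun {L : {set point} | L \in C} -> R[i]} :=
  [ffun L => radon f (val L)].

Fact radon_restr_is_linear (R : realType) (C : {set {set point}}) :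
  linear (@radon_restr R C).
Proof.
move=> a f g; apply/ffunP => L; rewrite !ffunE /radon scaler_sumr -big_split.
by apply: eq_bigr => x _; rewrite !ffunE.
Qed.

HB.instance Definition _ (R : realType) (C : {set {set point}}) :=
  GRing.isLinear.Build R[i] {ffun point -> R[i]}
    {ffun {L : {set point} | L \in C} -> R[i]} *:%R (@radon_restr R C)
    (@radon_restr_is_linear R C).

Definition admissible (R : realType) (C : {set {set point}}) : Prop :=
  injective (@radon_restr R C).

(* Main.v *)
From Stdlib Require Import NArith ZArith.
Require Import Defs.
From mathcomp Require Import all_boot all_order all_algebra.
From mathcomp Require Import boolp reals complex zify ring ssrZ.

Set Implicit Arguments.
Unset Strict Implicit.
Unset Printing Implicit Defensive.

Import GRing.Theory Num.Theory.

(* Keeps arithmetic on symbolic binary numbers in a form that lia recognizes. *)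
Local Arguments N.add : simpl never.
Local Arguments N.mul : simpl never.
Local Arguments N.of_nat : simpl never.

(** A line of a binary affine space is a pair of distinct points, so a line
complex is a simple graph on the points, and it is admissible iff a complex
function on the vertices whose two values cancel along every edge must vanish.
With as many edges as vertices, this says that the unsigned incidence matrix
is nonsingular (lemmas [linesE], [admissibleE]).  What has to be found is thus
the number a_n of nonsingular graphs with n vertices and n edges, for n = 16.

A leaf can be pruned together with its edge without changing nonsingularity:
the edge determines the value at the leaf from the value at its neighbour.
Two leaves are never adjacent, since the values 1 and -1 on such a pair would
lie in the kernel.  Hence, for a set U of k vertices, the nonsingular graphs in
which all the vertices of U are leaves number (n - k)^k a_(n-k): choose the
neighbours freely outside U, and a nonsingular graph on the rest
([card_nonsingular_leaves]).  Inclusion-exclusion gives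
[[
  sum_k (-1)^k C(n, k) (n - k)^k a_(n-k) = b_n
]]
where b_n counts the nonsingular graphs without leaves
([leaf_inclusion_exclusion]).  A nonsingular graph has no isolated vertex, so
without leaves all its degrees are at least 2; their sum being 2n, they all
equal 2.  So b_n counts nonsingular 2-regular graphs.

To compute b_n, fix a vertex v and look at a path w - v - u - t around an edge
at v.  If w = t, this is a triangle, which is itself nonsingular and can be
deleted.  If w and t differ, the path can be contracted to the single edge
w - t: along the path the value changes sign three times, so f w + f t = 0 is
what the path imposes on the remaining vertices.  The edge w - t cannot already be
present, because a 4-cycle is singular.  Counting the paths in two ways yields
[[
  2 b_n = (n - 1) (n - 2) (2 b_(n-2) + b_(n-3))
]]
([card_two_regular_rec], [card_two_regular_step]).  Both recursions are then
evaluated with binary integers.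

All graphs live on a fixed finite type T, and graphs on fewer vertices are
graphs supported on a subset S of T; pruning and contraction then need no
relabelling. *)

Lemma natrZ n : n%:R%R = Z.of_nat n.
Proof. by rewrite -[in RHS](natn n) rmorph_nat. Qed.

(** * Graphs as sets of pairs: degrees and local replacement *)

Section Graphs.
Variable T : finType.
Implicit Types (S U : {set T}) (C K A B : {set {set T}}) (L : {set T}).

Definition edges S : {set {set T}} :=
  [set L : {set T} | (L \subset S) && (#|L| == 2)].

Definition deg C x := \sum_(L in C) (x \in L : nat).

Lemma edgesP S L :
  reflect (exists x y, [/\ x \in S, y \in S, x != y & L = [set x; y]])
          (L \in edges S).
Proof.
rewrite inE; apply: (iffP andP) => [[sLS /cards2P[x [y [xNy eL]]]]|].
  by exists x, y; move: sLS; rewrite eL subUset !sub1set => /andP[].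
by case=> x [y [Sx Sy xNy ->]]; rewrite subUset !sub1set Sx Sy cards2 xNy.
Qed.

Lemma deg_eq0 C x L : deg C x = 0 -> L \in C -> x \notin L.
Proof.
move=> /eqP; rewrite sum_nat_eq0 => /forall_inP C0 /C0.
by rewrite eqb0.
Qed.

(** Expressing the support through degrees lets deletions and contractions be
checked by adding degrees, without inspecting edges. *)
Lemma edges_degP S C :
  reflect (C \subset edges setT /\ forall x, x \notin S -> deg C x = 0)
          (C \subset edges S).
Proof.
apply: (iffP subsetP) => [CS | [/subsetP CT C0] L CL].
  split=> [|x xS].
    by apply/subsetP => L /CS; rewrite !inE subsetT => /andP[].
  rewrite /deg big1 // => L /CS; rewrite inE => /andP[/subsetP sLS _].
  by case: (boolP (x \in L)) => // /sLS xS'; rewrite xS' in xS.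
have := CT L CL; rewrite !inE subsetT /= => ->; rewrite andbT.
apply/subsetP => x xL; apply: contraLR xL => /C0 dx.
exact: deg_eq0 dx CL.
Qed.

Lemma set2_inj (x y z : T) : [set x; y] = [set x; z] -> y = z.
Proof.
move=> /setP e; move: (e y) (e z); rewrite !inE !eqxx !orbT.
by case: (eqVneq y x) => [->|_] /=; [case: (eqVneq z x)|move=> /esym /eqP].
Qed.

Lemma deg_neighbours S C x : C \subset edges S ->
  deg C x = \sum_(y in S :\ x) ([set x; y] \in C : nat).
Proof.
move=> CS; rewrite -big_mkcondr /= sum1dep_card /deg -big_mkcondr /= sum1dep_card.
rewrite -(@card_imset _ _ (fun y => [set x; y])); last by move=> y z /set2_inj.
apply: eq_card => L; rewrite inE; apply/idP/imsetP => [/andP[LC xL]|].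
  have /edgesP[y [z [yS zS yNz eL]]] := subsetP CS L LC.
  move: xL; rewrite eL !inE => /orP[]/eqP ->.
    by exists z => //; rewrite !inE eq_sym yNz zS -eL LC.
  by exists y; rewrite 1?setUC // !inE yNz yS setUC -eL LC.
by case=> y; rewrite inE => /andP[_ yC] ->; rewrite yC !inE eqxx.
Qed.

Lemma handshake S C : C \subset edges S -> \sum_(x in S) deg C x = 2 * #|C|.
Proof.
move=> CS; rewrite exchange_big /= mulnC -sum_nat_const.
apply: eq_bigr => L /(subsetP CS); rewrite inE => /andP[sLS /eqP <-].
rewrite -big_mkcondr /= sum1dep_card; apply: eq_card => x; rewrite inE.
by case: (boolP (x \in L)) => [/(subsetP sLS) -> | _] //; rewrite andbF.
Qed.

Lemma degU A B x : [disjoint A & B] -> deg (A :|: B) x = deg A x + deg B x.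
Proof. by move=> dAB; rewrite /deg -bigU //; apply: eq_bigl => L; rewrite !inE. Qed.

Lemma deg0 x : deg set0 x = 0. Proof. exact: big_set0. Qed.

Lemma degU1 L C x : L \notin C -> deg (L |: C) x = (x \in L) + deg C x.
Proof. by move=> LC; rewrite /deg big_setU1. Qed.

Lemma deg1 L x : deg [set L] x = (x \in L).
Proof. exact: big_set1. Qed.

(** All the bijections of this proof replace a fixed configuration A of edges by
another one B and keep the rest K.  Since A and B are fixed, the replacement
can be undone, hence is injective. *)
Lemma leq_card_swap A B (X Y : {set {set {set T}}}) :
  (forall C, C \in X -> (A \subset C) && [disjoint B & C]) ->
  (forall K, [disjoint A & K] -> [disjoint B & K] ->
     K :|: A \in X -> K :|: B \in Y) ->
  #|X| <= #|Y|.
Proof.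
move=> XA XY.
have splitA C : C \in X -> (C :\: A) :|: A = C.
  by move=> /XA/andP[sAC _]; rewrite setUC -{1}(setIidPr sAC) setID.
have dA C : [disjoint A & C :\: A].
  by rewrite disjoint_sym disjoints_subset setDE subsetIr.
have dB C : C \in X -> [disjoint B & C :\: A].
  by move=> /XA/andP[_]; apply: disjointWr; apply: subsetDl.
pose h C := (C :\: A) :|: B.
have hK C : C \in X -> (h C :\: B) :|: A = C.
  move=> CX; rewrite /h setDUl setDv setU0 -[RHS](splitA C CX); congr (_ :|: _).
  by apply/setDidPl; rewrite disjoint_sym dB.
rewrite -(@card_in_imset _ _ h); last first.
  by move=> C1 C2 C1X C2X e; rewrite -(hK _ C1X) e hK.
apply: subset_leq_card; apply/subsetP => _ /imsetP[C CX ->].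
by apply: XY => //; rewrite ?dB // splitA.
Qed.

Lemma card_swap A B (X Y : {set {set {set T}}}) :
  (forall C, C \in X -> (A \subset C) && [disjoint B & C]) ->
  (forall C, C \in Y -> (B \subset C) && [disjoint A & C]) ->
  (forall K, [disjoint A & K] -> [disjoint B & K] ->
     (K :|: A \in X) = (K :|: B \in Y)) ->
  #|X| = #|Y|.
Proof.
move=> XA YB XY; apply/eqP; rewrite eqn_leq.
by rewrite (leq_card_swap XA) ?(leq_card_swap YB) // => K dA dB; rewrite XY.
Qed.

(** * Nonsingular graphs *)

Variable F : numDomainType.
Implicit Type f : T -> F.
Local Open Scope ring_scope.

Definition kills f C := forall L, L \in C -> \sum_(x in L) f x = 0.

(** Injectivity of the edge-sum map on functions supported on S, written for
functions on T so that S can vary. *)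
Definition determined S C : bool :=
  `[< forall f, kills f C -> {in S, forall x, f x = 0} >].

Lemma sum_pair f x y : x != y -> \sum_(z in [set x; y]) f z = f x + f y.
Proof. by move=> xNy; rewrite big_setU1 ?inE ?xNy // big_set1. Qed.

Lemma killsU f A B : kills f (A :|: B) <-> kills f A /\ kills f B.
Proof.
split=> [fAB|[fA fB] L].
  by split=> L Lin; apply: fAB; rewrite inE Lin ?orbT.
by rewrite inE => /orP[/fA|/fB].
Qed.

Lemma kills1 f x y : x != y -> kills f [set [set x; y]] <-> f x + f y = 0.
Proof.
move=> xNy; split=> [fk|e L].
  by rewrite -sum_pair //; apply: fk; rewrite inE.
by rewrite inE => /eqP ->; rewrite sum_pair.
Qed.

(** Extending a function to the vertices removed from a graph does not affect the
edges that stay, because these avoid the removed vertices. *)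
Lemma eq_kills f g C : (forall x, deg C x <> 0%N -> f x = g x) ->
  kills f C -> kills g C.
Proof.
move=> fg fC L LC; apply: etrans (fC L LC); apply: eq_bigr => x xL.
by rewrite fg // => /deg_eq0/(_ LC); rewrite xL.
Qed.


Lemma determined_eq0 S C f : determined S C -> kills f C -> {in S, forall x, f x = 0}.
Proof. by move=> /asboolP dC /dC. Qed.

(** The edge at the leaf u forces f u = - f w, so a function on the pruned graph
extends in exactly one way. *)
Lemma determined_leaf S K u w : u \in S -> w \in S -> u != w -> deg K u = 0%N ->
  determined S (K :|: [set [set u; w]]) = determined (S :\ u) K.
Proof.
move=> uS wS uNw dK; apply/asboolP/asboolP => dC f.
  move=> fK x; rewrite !inE => /andP[xNu xS].
  pose g y := if y == u then - f w else f y.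
  have gx : g x = f x by rewrite /g (negPf xNu).
  rewrite -gx; apply: dC xS; apply/killsU; split; last first.
    by apply/kills1 => //; rewrite /g eqxx eq_sym (negPf uNw) addNr.
  by apply: eq_kills fK => y; rewrite /g; case: eqP => // ->; rewrite dK.
case/killsU => /dC fK /(kills1 f uNw) fuw x xS.
have fw : f w = 0 by apply: fK; rewrite !inE eq_sym uNw.
have fu : f u = 0 by rewrite -fuw fw addr0.
by have [->//|xNu] := eqVneq x u; apply: fK; rewrite !inE xNu.
Qed.

(** * Pruning leaves *)

Definition nonsingular S := [set C : {set {set T}} |
  [&& C \subset edges S, #|C| == #|S| & determined S C]].

Definition nonsingular_leaves S U :=
  [set C in nonsingular S | [forall u in U, deg C u == 1%N]].

Lemma edge_deg_gt0 C x y : [set x; y] \in C -> (0 < deg C x)%N.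
Proof.
rewrite lt0n; apply: contraTneq => d0; apply/negP => /(deg_eq0 d0).
by rewrite !inE eqxx.
Qed.

(** The neighbour w must be outside U: this keeps the degrees of the other
vertices of U unchanged when the edge is removed. *)
Lemma leaf_step S U u w : u \in U -> U \subset S -> w \in S :\: U ->
  #|[set C in nonsingular_leaves S U | [set u; w] \in C]| =
  #|nonsingular_leaves (S :\ u) (U :\ u)|.
Proof.
move=> uU US; rewrite inE => /andP[wU wS]; have uS := subsetP US u uU.
have uNw : u != w by apply: contraNneq wU => <-.
apply: (@card_swap [set [set u; w]] set0) => [C|C|K].
- by rewrite inE sub1set => /andP[_ ->]; rewrite disjoints_subset sub0set.
- rewrite inE => /andP[]; rewrite inE => /and3P[/edges_degP[_ d0] _ _] _.
  rewrite sub0set disjoints_subset sub1set inE /=; apply/negP => /edge_deg_gt0.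
  by rewrite d0 // !inE eqxx.
move=> dA _; rewrite setU0.
have dK x : deg (K :|: [set [set u; w]]) x = (deg K x + (x \in [set u; w]))%N.
  by rewrite degU ?deg1 // disjoint_sym.
have cK : #|K :|: [set [set u; w]]| = #|K|.+1.
  by rewrite setUC cardsU1 -disjoints1 dA.
rewrite !inE !eqxx orbT andbT cK (cardsD1 u S) uS eqSS.
apply/andP/andP => -[/and3P[sE ->]] D /forall_inP L1.
  have du : deg K u = 0%N.
    by have /eqP := L1 u uU; rewrite dK !inE eqxx addn1 => -[].
  rewrite -(determined_leaf uS wS) // D !andbT; split.
    have [sT d0] := edges_degP _ _ sE.
    apply/edges_degP; split; first by apply: subset_trans sT; apply: subsetUl.
    move=> x; rewrite !inE negb_and negbK => /orP[/eqP->//|/d0].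
    by rewrite dK => /eqP; rewrite addn_eq0 => /andP[/eqP].
  apply/forall_inP => x; rewrite !inE => /andP[xNu xU].
  rewrite -(eqP (L1 x xU)) dK !inE.
  by rewrite (negPf xNu) (_ : x == w = false) ?addn0 //; apply: contraNF wU => /eqP <-.
have [sT d0] := edges_degP _ _ sE.
have du : deg K u = 0%N by apply: d0; rewrite !inE eqxx.
rewrite (determined_leaf uS wS) // D andbT /= subUset sub1set; split.
  rewrite andbT; apply/andP; split; last by apply/edgesP; exists u, w.
  apply: subset_trans sE _; apply/subsetP => L.
  by rewrite !inE subsetD1 => /andP[/andP[-> _] ->].
apply/forall_inP => x xU; rewrite dK !inE.
have [->|xNu] := eqVneq x u; first by rewrite du.
rewrite (_ : x == w = false); last by apply: contraNF wU => /eqP <-.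
by rewrite addn0; apply: L1; rewrite !inE xNu.
Qed.


(** The tool to show that a configuration A is forbidden: a kernel function of A
that vanishes on all the vertices shared with the rest K of the graph extends
by zero. *)
Lemma no_local_kernel S K A f : determined S (K :|: A) -> kills f A ->
  (forall x, deg K x <> 0%N -> f x = 0) -> {in S, forall x, f x = 0}.
Proof.
move=> dKA fA fK; apply: (determined_eq0 dKA); apply/killsU; split=> //.
have z0 : kills (fun=> 0) K by move=> L _; rewrite big1.
by apply: eq_kills z0 => x /fK.
Qed.

(** Two adjacent leaves form a component with a single edge, whose kernel contains
the function 1, -1. *)
Lemma leaves_nonadjacent S C u w : determined S C -> C \subset edges S ->
  u \in S -> u != w -> deg C u = 1%N -> deg C w = 1%N -> [set u; w] \notin C.
Proof.
move=> dC CS uS uNw du dw; apply/negP => uwC.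
pose f x : F := (x == u)%:R - (x == w)%:R.
have eC : C = C :\ [set u; w] :|: [set [set u; w]] by rewrite setUC setD1K.
have degC x : deg C x = (deg (C :\ [set u; w]) x + (x \in [set u; w]))%N.
  by rewrite addnC -degU1 ?setD1K // setD11.
suff /eqP : f u = 0 by rewrite /f eqxx (negPf uNw) subr0 oner_eq0.
rewrite eC in dC; apply: (no_local_kernel dC) uS.
  by apply/kills1; rewrite // /f !eqxx (eq_sym w) (negPf uNw) subr0 sub0r subrr.
move=> x dx; rewrite /f; have [xu|_] := eqVneq x u.
  by case: dx; move: du; rewrite -xu degC !inE xu eqxx addn1 => -[].
have [xw|_] := eqVneq x w; last by rewrite subrr.
by case: dx; move: dw; rewrite -xw degC !inE xw eqxx orbT addn1 => -[].
Qed.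

Lemma card_double_count (I J : finType) (X : {set I}) (D : {set J})
    (Q : I -> J -> bool) k :
  (forall i, i \in X -> \sum_(j in D) (Q i j : nat) = k)%N ->
  (k * #|X| = \sum_(j in D) #|[set i in X | Q i j]|)%N.
Proof.
move=> XD; rewrite mulnC -sum_nat_const -(eq_bigr _ XD) exchange_big /=.
by apply: eq_bigr => j _; rewrite -big_mkcondr /= sum1dep_card.
Qed.

(** Each leaf in U has exactly one neighbour, and it lies outside U; summing over
that neighbour and pruning one leaf of U at a time gives one factor for each. *)
Lemma card_nonsingular_leaves S U : U \subset S ->
  #|nonsingular_leaves S U| = (#|S :\: U| ^ #|U| * #|nonsingular (S :\: U)|)%N.
Proof.
move=> US; have [n] := ubnP #|U|; elim: n S U US => // n IHn S U US leUn.
have [->|[u uU]] := set_0Vmem U.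
  rewrite cards0 setD0 mul1n; apply: eq_card => C; rewrite inE.
  by rewrite (_ : [forall _ in _, _]) ?andbT //; apply/forall_inP => u; rewrite inE.
have uS := subsetP US u uU.
have eSU : S :\ u :\: (U :\ u) = S :\: U.
  apply/setP => x; rewrite !inE negb_and negbK; have [->|] //= := eqVneq x u.
  by rewrite uU.
rewrite -[LHS]mul1n (@card_double_count _ _ _ (S :\: U) (fun C w => [set u; w] \in C)).
  rewrite (eq_bigr _ (fun w => leaf_step uU US)) sum_nat_const IHn ?setSD //.
    by rewrite eSU (cardsD1 u U) uU expnS mulnA.
  by move: leUn; rewrite (cardsD1 u U) uU.
move=> C; rewrite inE => /andP[]; rewrite inE => /and3P[CS _ dC] /forall_inP d1.
have /eqP := d1 u uU; rewrite (deg_neighbours _ CS) => e1; rewrite -[RHS]e1.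
rewrite [RHS](bigID (fun w => w \in U)) /= [X in _ = (X + _)%N]big1 ?add0n.
  apply: eq_bigl => x; rewrite !inE andbC; have [->|] //= := eqVneq x u.
  by rewrite uU andbF.
move=> w /andP[]; rewrite !inE => /andP[wNu wS] wU.
by rewrite (negPf (leaves_nonadjacent dC CS uS _ _ _)) // 1?eq_sym //; apply/eqP/d1.
Qed.

(** Expand the product of the factors 1 - [x in S] over all x. *)
Lemma sum_sign_subsets (K : comPzRingType) S :
  \sum_(U : {set T} | U \subset S) (-1) ^+ #|U| = (S == set0)%:R :> K.
Proof.
transitivity (\prod_(x : T) ((if x \in S then -1 else 0) + 1 : K)).
  rewrite bigA_distr big_mkcond /=; apply: eq_bigr => U _.
  rewrite -big_mkcond /=; have [US|/subsetPn[x xU xS]] := boolP (U \subset S).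
    rewrite (eq_bigr (fun=> -1)) ?prodr_const // => x /(subsetP US) -> //.
  by rewrite (bigD1 x) //= (negPf xS) mul0r.
have [->|[x xS]] := set_0Vmem S.
  by rewrite eqxx big1 // => x _; rewrite inE add0r.
rewrite (bigD1 x) //= xS addNr mul0r; case: eqP => // S0.
by rewrite S0 inE in xS.
Qed.

(** * Two-regular graphs *)

(** The condition on degrees outside S makes S the set of vertices, and the number
of edges is then #|S| by the handshake identity. *)
Definition two_regular S := [set C : {set {set T}} |
  [&& C \subset edges setT, [forall x, deg C x == 2 * (x \in S)]%N & determined S C]].

Lemma two_regular_edges S C : C \in two_regular S -> C \subset edges S.
Proof.
rewrite inE => /and3P[CT /forallP d2 _]; apply/edges_degP; split=> // x xS.
by rewrite (eqP (d2 x)) (negPf xS).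
Qed.

Lemma determined_deg_gt0 S C x : determined S C -> x \in S -> (0 < deg C x)%N.
Proof.
rewrite -[C]setU0 => dC xS; rewrite lt0n; apply/eqP; rewrite setU0 => d0.
pose f y : F := (y == x)%:R.
have /eqP : f x = 0; last by rewrite /f eqxx oner_eq0.
apply: (no_local_kernel dC) xS => [L|y]; first by rewrite inE.
by rewrite /f; have [->|] := eqVneq y x.
Qed.

(** Without leaves every degree is at least 2, while the average degree is exactly
2; equality must hold at each vertex. *)
Lemma nonsingular_leafless S C :
  (C \in nonsingular S) && ([set x in S | deg C x == 1%N] == set0) =
  (C \in two_regular S).
Proof.
apply/andP/idP => [[]|CB].
  rewrite inE => /and3P[CS /eqP cC dC] /eqP/setP no1; rewrite inE dC andbT.
  have [-> d0] := edges_degP _ _ CS; apply/forallP => x.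
  have [xS|/d0->//] := boolP (x \in S); rewrite muln1.
  have d2 y : y \in S -> (2 <= deg C y ?= iff (deg C y == 2))%N.
    move=> yS; split; last by rewrite eq_sym.
    have := no1 y; rewrite !inE yS ltn_neqAle eq_sym /=.
    by rewrite (determined_deg_gt0 dC yS) => ->.
  have := leqif_sum d2; rewrite handshake // sum_nat_const mulnC cC => -[_].
  by rewrite eqxx => /esym/forall_inP/(_ x xS).
have CS := two_regular_edges CB.
move: CB; rewrite !inE CS => /and3P[_ /forallP d2 ->]; rewrite andbT; split.
  rewrite -(eqn_pmul2l (isT : (0 < 2)%N)) -(handshake CS) mulnC -sum_nat_const.
  by apply/eqP/eq_bigr => x xS; rewrite (eqP (d2 x)) xS.
by apply/eqP/setP => x; rewrite !inE (eqP (d2 x)); case: (x \in S).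
Qed.

(** After exchanging the sums, each graph C contributes the alternating sum over the
subsets of its set of leaves, which is 1 if C is leafless and 0 otherwise. *)
Lemma leaf_inclusion_exclusion (K : comPzRingType) S :
  \sum_(U : {set T} | U \subset S)
     (-1) ^+ #|U| * (#|S :\: U| ^ #|U| * #|nonsingular (S :\: U)|)%:R
  = #|two_regular S|%:R :> K.
Proof.
under eq_bigr => U US do rewrite -card_nonsingular_leaves //.
transitivity (\sum_(C in nonsingular S)
   \sum_(U : {set T} | U \subset [set x in S | deg C x == 1%N]) (-1) ^+ #|U| : K).
  rewrite (exchange_big_dep (fun U : {set T} => U \subset S)) /=; last first.
    by move=> C U _ /subset_trans; apply; apply/subsetP => x; rewrite inE => /andP[].
  apply: eq_bigr => U US.
  rewrite -[#|nonsingular_leaves _ _|]sum1_card natr_sum mulr_sumr.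
  apply: eq_big => [C|C _]; last by rewrite mulr1.
  rewrite inE; congr (_ && _); apply/forall_inP/subsetP => d1 x xU.
    by rewrite inE (subsetP US x xU) d1.
  by have := d1 x xU; rewrite inE => /andP[].
under eq_bigr => C _ do rewrite sum_sign_subsets.
rewrite -natr_sum -big_mkcondr /= sum1_card; congr (_%:R); apply: eq_card => C.
exact: nonsingular_leafless.
Qed.


(** * Contracting paths and deleting triangles *)

(** The path w - v - u - t; for w = t it is a triangle, a case that the lemmas not
assuming w != t are meant to cover. *)
Definition path3 w v u t : {set {set T}} :=
  [set [set v; u]; [set v; w]; [set u; t]].

Lemma path3_meets w v u t L : L \in path3 w v u t -> (v \in L) || (u \in L).
Proof. by rewrite !inE => /orP[/orP[]|] /eqP ->; rewrite !inE eqxx ?orbT. Qed.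

Section Path3.
Variables w v u t : T.
Hypotheses (vNu : v != u) (vNw : v != w) (uNw : u != w) (vNt : v != t) (uNt : u != t).

Lemma deg_path3 x :
  deg (path3 w v u t) x = (2 * (x \in [set v; u]) + ((x == w) + (x == t)))%N.
Proof.
have e1 : [set v; u] != [set v; w] by apply: contraNneq uNw => /set2_inj ->.
have mem_neq (L1 L2 : {set T}) y : y \in L1 -> y \notin L2 -> L1 != L2.
  by move=> yL1; apply: contraNneq => <-.
have e2 : [set v; u] != [set u; t].
  by apply: (mem_neq _ _ v); rewrite !inE ?eqxx // (negPf vNu) (negPf vNt).
have e3 : [set v; w] != [set u; t].
  by apply: (mem_neq _ _ v); rewrite !inE ?eqxx // (negPf vNu) (negPf vNt).
rewrite /path3 setUC degU1; last by rewrite !inE negb_or ![[set u; t] == _]eq_sym e2 e3.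
rewrite degU1 ?inE // deg1.
rewrite !inE.
have [->|xNv] := eqVneq x v.
  by rewrite (negPf vNu) (negPf vNw) (negPf vNt).
have [->|xNu] := eqVneq x u => //=.
  by rewrite (negPf uNw) (negPf uNt).
by rewrite add0n addnC.
Qed.

Lemma kills_path3 f :
  kills f (path3 w v u t) <-> [/\ f v + f u = 0, f v + f w = 0 & f u + f t = 0].
Proof.
split=> [/killsU[/killsU[]]|[e1 e2 e3]].
  by move=> /(kills1 f vNu) e1 /(kills1 f vNw) e2 /(kills1 f uNt).
by apply/killsU; split; [apply/killsU; split|]; apply/kills1.
Qed.

Lemma path3_edges : path3 w v u t \subset edges setT.
Proof.
by apply/subsetP => L; rewrite !inE => /orP[/orP[]|] /eqP ->;
  rewrite subsetT cards2 ?vNu ?vNw ?uNt.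
Qed.

(** On a kernel function f w = - f v = f u = - f t, so the edges of the path amount
to the relation f w + f t = 0 together with the values at v and u. *)
Lemma determined_contract S K : v \in S -> u \in S -> w \in S -> w != t ->
  deg K v = 0%N -> deg K u = 0%N ->
  determined S (K :|: path3 w v u t) =
  determined (S :\: [set v; u]) (K :|: [set [set w; t]]).
Proof.
move=> vS uS wS wNt dv du; apply/asboolP/asboolP => dC f.
  case/killsU => fK /(kills1 f wNt) fwt x; rewrite !inE negb_or.
  move=> /andP[/andP[xNv xNu] xS].
  pose g y := if y == v then - f w else if y == u then - f t else f y.
  have gx : g x = f x by rewrite /g (negPf xNv) (negPf xNu).
  rewrite -gx; apply: dC xS; apply/killsU; split.
    apply: eq_kills fK => y dy; rewrite /g.
    case: eqP dy => [->|_]; first by rewrite dv.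
    by case: eqP => // ->; rewrite du.
  apply/kills_path3 => //; rewrite /g !eqxx.
  rewrite (eq_sym u v) !(eq_sym w) !(eq_sym t).
  rewrite (negPf vNu) (negPf vNw) (negPf vNt) (negPf uNw) (negPf uNt) !addNr.
  by rewrite -opprD fwt oppr0.
case/killsU => fK /kills_path3[e1 e2 e3].
have f0 : {in S :\: [set v; u], forall x, f x = 0}.
  apply: dC; apply/killsU; split=> //; apply/kills1 => //.
  have -> : f w + f t = (f v + f w) + (f u + f t) - (f v + f u) by ring.
  by rewrite e1 e2 e3 addr0 subrr.
have fw : f w = 0 by apply: f0; rewrite !inE negb_or wS ![w == _]eq_sym vNw uNw.
have fv : f v = 0 by rewrite -e2 fw addr0.
have fu : f u = 0 by rewrite -e1 fv add0r.
move=> x xS; have [->//|xNv] := eqVneq x v; have [->//|xNu] := eqVneq x u.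
by apply: f0; rewrite !inE negb_or xNv xNu.
Qed.

End Path3.

(** The triangle forces 2 f v = 0, so it determines its own values. *)
Lemma determined_triangle S K v u w :
  v != u -> v != w -> u != w -> deg K v = 0%N -> deg K u = 0%N -> deg K w = 0%N ->
  determined S (K :|: path3 w v u w) = determined (S :\: [set v; u; w]) K.
Proof.
move=> vNu vNw uNw dv du dw; apply/asboolP/asboolP => dC f.
  move=> fK x; rewrite inE => /andP[xN xS].
  pose g y := if y \in [set v; u; w] then 0 else f y.
  have gx : g x = f x by rewrite /g (negPf xN).
  rewrite -gx; apply: dC xS; apply/killsU; split.
    apply: eq_kills fK => y dy; rewrite /g; case: ifP => //.
    by rewrite !inE => /orP[/orP[]|] /eqP ey; case: dy; rewrite ey.
  by apply/kills_path3 => //; rewrite /g !inE !eqxx !orbT /= !addr0.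
case/killsU => fK /kills_path3[] // e1 e2 e3.
have fv : f v = 0.
  have /eqP : f v *+ 2 = (f v + f u) + (f v + f w) - (f u + f w) by ring.
  by rewrite e1 e2 e3 addr0 subrr mulrn_eq0 => /eqP.
have fu : f u = 0 by rewrite -e1 fv add0r.
have fw : f w = 0 by rewrite -e2 fv add0r.
move=> x xS; case: (boolP (x \in [set v; u; w])) => [|xN].
  by rewrite !inE => /orP[/orP[]|] /eqP ->.
by apply: dC => //; rewrite inE xN.
Qed.

(** Signs alternate consistently around an even cycle. *)
Lemma four_cycle_singular S K v u w t :
  v != u -> v != w -> u != w -> v != t -> u != t -> w != t -> v \in S ->
  deg K v = 0%N -> deg K u = 0%N -> deg K w = 0%N -> deg K t = 0%N ->
  ~~ determined S (K :|: (path3 w v u t :|: [set [set w; t]])).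
Proof.
move=> vNu vNw uNw vNt uNt wNt vS dv du dw dt; apply/negP => dC.
pose f x : F := (x \in [set v; t])%:R - (x \in [set u; w])%:R.
have fv : f v = 1 by rewrite /f !inE eqxx (negPf vNu) (negPf vNw) subr0.
have ft : f t = 1.
  by rewrite /f !inE eqxx orbT ![t == _]eq_sym (negPf uNt) (negPf wNt) subr0.
have fu : f u = -1 by rewrite /f !inE eqxx eq_sym (negPf vNu) (negPf uNt) sub0r.
have fw : f w = -1.
  by rewrite /f !inE eqxx orbT [w == v]eq_sym (negPf vNw) (negPf wNt) sub0r.
have /eqP : f v = 0; last by rewrite fv oner_eq0.
apply: (no_local_kernel dC) vS.
  apply/killsU; split; last by apply/kills1; rewrite // fw ft addNr.
  by apply/kills_path3; rewrite // fv fu fw ft subrr addNr.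
move=> x dx; rewrite /f !inE.
have [xv|_] := eqVneq x v; first by case: dx; rewrite xv.
have [xt|_] := eqVneq x t; first by case: dx; rewrite xt.
have [xu|_] := eqVneq x u; first by case: dx; rewrite xu.
have [xw|_] := eqVneq x w; first by case: dx; rewrite xw.
by rewrite subrr.
Qed.

(** At v and u the path has degree 2 and the edge w - t has degree 0, and both have
the same degrees elsewhere, so the replacement preserves 2-regularity.  The
edge w - t is absent before the replacement, since it would close a 4-cycle. *)
Lemma card_two_regular_contract S v u w t :
  v \in S -> u \in S -> w \in S -> t \in S ->
  v != u -> v != w -> u != w -> v != t -> u != t -> w != t ->
  #|[set C in two_regular S | path3 w v u t \subset C]| =
  #|[set C in two_regular (S :\: [set v; u]) | [set w; t] \in C]|.
Proof.
move=> vS uS wS tS vNu vNw uNw vNt uNt wNt.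
have dP := deg_path3 vNu vNw uNw vNt uNt.
have wtP : [set w; t] \notin path3 w v u t.
  apply/negP => /path3_meets; rewrite !inE.
  by rewrite (negPf vNw) (negPf vNt) (negPf uNw) (negPf uNt).
apply: (@card_swap (path3 w v u t) [set [set w; t]]) => [C|C|K].
- rewrite inE disjoints1 => /andP[CB PC]; rewrite PC /=; apply/negP => wtC.
  move: CB; rewrite inE => /and3P[_ /forallP d2 dC].
  (* If w - t were an edge, then A would exhaust the degrees of its vertices and
     be a component of C. *)
  pose A := path3 w v u t :|: [set [set w; t]].
  have AC : A \subset C by rewrite subUset PC sub1set.
  have dA : [disjoint C :\: A & A] by rewrite disjoints_subset setDE subsetIr.
  have eC : C = C :\: A :|: A by rewrite setUC -{1}(setIidPr AC) setID.
  have d0 x : x \in S -> deg A x = 2%N -> deg (C :\: A) x = 0%N.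
    by move=> xS eA; have /eqP := d2 x; rewrite {1}eC degU // eA xS addn2 => -[].
  have eA x : deg A x = (deg (path3 w v u t) x + (x \in [set w; t]))%N.
    by rewrite /A degU ?deg1 // disjoint_sym disjoints1 wtP.
  have P2 x : x \in [set v; u; w; t] -> deg A x = 2%N.
    rewrite eA dP !inE => /orP[/orP[/orP[]|]|] /eqP ->; rewrite !eqxx.
    - by rewrite (negPf vNw) (negPf vNt).
    - by rewrite orbT (negPf uNw) (negPf uNt).
    - by rewrite (negPf wNt) !(eq_sym w) (negPf vNw) (negPf uNw).
    - by rewrite orbT !(eq_sym t) (negPf wNt) (negPf vNt) (negPf uNt).
  have := @four_cycle_singular S (C :\: A) v u w t.
  rewrite -/A -eC dC vNu vNw uNw vNt uNt wNt vS.
  move=> /(_ isT isT isT isT isT isT isT) singC; suff: ~~ true by [].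
  by apply: singC; apply: d0; rewrite // P2 // !inE eqxx ?orbT.
- rewrite inE => /andP[CB wtC]; rewrite sub1set wtC /= disjoints_subset.
  apply/subsetP => L /path3_meets vuL; rewrite inE; apply/negP => LC.
  have [_ d0] := edges_degP _ _ (two_regular_edges CB).
  by case/orP: vuL => xL; move: xL; apply/negP; apply: (deg_eq0 _ LC); apply: d0;
    rewrite !inE eqxx ?orbT.
move=> dA dB; rewrite !inE subsetUr eqxx orbT !andbT.
have wtE : [set [set w; t]] \subset edges setT.
  by rewrite sub1set inE subsetT cards2 wNt.
rewrite !(subUset _ K) wtE path3_edges // !andbT; congr (_ && _).
have eA x : deg (K :|: path3 w v u t) x = (deg K x + deg (path3 w v u t) x)%N.
  by rewrite degU // disjoint_sym.
have eB x : deg (K :|: [set [set w; t]]) x = (deg K x + (x \in [set w; t]))%N.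
  by rewrite degU ?deg1 // disjoint_sym.
have d2E : [forall x, deg (K :|: path3 w v u t) x == 2 * (x \in S)]%N =
   [forall x, deg (K :|: [set [set w; t]]) x == 2 * (x \in S :\: [set v; u])]%N.
  apply: eq_forallb => x; rewrite eA eB dP !inE.
  have [->|xNv] := eqVneq x v.
    rewrite vS (negPf vNw) (negPf vNt) /=.
    by rewrite !addn0 muln1 muln0 (eqn_add2r 2 _ 0).
  have [->|xNu] := eqVneq x u.
    rewrite uS (negPf uNw) (negPf uNt) /=.
    by rewrite !addn0 muln1 muln0 (eqn_add2r 2 _ 0).
  rewrite /= muln0 add0n; congr (_ + _ == _)%N; have [->|//] := eqVneq x w.
  by rewrite (negPf wNt).
rewrite d2E; apply: andb_id2l => /forallP d2.
have dK0 x : x \in [set v; u] -> deg K x = 0%N.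
  move=> xvu; have /eqP := d2 x; rewrite eB in_setD xvu => /eqP.
  by rewrite addn_eq0 => /andP[/eqP].
by rewrite determined_contract // dK0 // !inE eqxx ?orbT.
Qed.

Lemma card_two_regular_triangle S v u w :
  v \in S -> u \in S -> w \in S -> v != u -> v != w -> u != w ->
  #|[set C in two_regular S | path3 w v u w \subset C]| =
  #|two_regular (S :\: [set v; u; w])|.
Proof.
move=> vS uS wS vNu vNw uNw; have dP := deg_path3 vNu vNw uNw vNw uNw.
apply: (@card_swap (path3 w v u w) set0) => [C|C CB|K dA _].
- by rewrite inE disjoints_subset sub0set => /andP[_ ->].
- rewrite sub0set disjoints_subset; apply/subsetP => L /path3_meets vuL.
  have [_ d0] := edges_degP _ _ (two_regular_edges CB).
  rewrite inE; apply/negP => LC.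
  by case/orP: vuL => xL; move: xL; apply/negP; apply: (deg_eq0 _ LC); apply: d0;
    rewrite !inE eqxx ?orbT.
rewrite setU0 !inE subsetUr !andbT (subUset _ K) path3_edges // andbT; congr (_ && _).
have dK x : (deg (K :|: path3 w v u w) x == 2 * (x \in S))%N =
            (deg K x == 2 * (x \in S :\: [set v; u; w]))%N.
  rewrite degU 1?disjoint_sym // dP !inE.
  have [->|xNv] := eqVneq x v.
    by rewrite vS (negPf vNw) /= !addn0 muln1 muln0 (eqn_add2r 2 _ 0).
  have [->|xNu] := eqVneq x u.
    by rewrite uS (negPf uNw) /= !addn0 muln1 muln0 (eqn_add2r 2 _ 0).
  have [->|_] := eqVneq x w; first by rewrite wS /= muln1 muln0 (eqn_add2r 2 _ 0).
  by rewrite /= !addn0.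
rewrite (eq_forallb dK); apply: andb_id2l => /forallP d2.
have dK0 x : x \in [set v; u; w] -> deg K x = 0%N.
  by move=> xvuw; have /eqP := d2 x; rewrite in_setD xvuw.
by rewrite determined_triangle // dK0 // !inE eqxx ?orbT.
Qed.

Lemma other_neighbour S C x y : C \in two_regular S -> x \in S -> y \in S -> x != y ->
  [set x; y] \in C -> (\sum_(z in S :\: [set x; y]) ([set x; z] \in C : nat) = 1)%N.
Proof.
move=> CB xS yS xNy xyC; have := deg_neighbours x (two_regular_edges CB).
move: CB; rewrite inE => /and3P[_ /forallP/(_ x)/eqP -> _].
rewrite xS (big_setD1 y) /=; last by rewrite !inE eq_sym xNy yS.
by rewrite xyC setDDl => -[].
Qed.

Lemma sum_two_regular_edges S :
  (\sum_(w in S) \sum_(t in S :\ w) #|[set C in two_regular S | [set w; t] \in C]| =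
   2 * #|S| * #|two_regular S|)%N.
Proof.
transitivity (\sum_(C in two_regular S) \sum_(w in S) deg C w)%N.
  rewrite [RHS]exchange_big /=; apply: eq_bigr => w wS.
  rewrite [RHS](eq_bigr (fun C => \sum_(t in S :\ w) ([set w; t] \in C : nat)))%N.
    rewrite [RHS]exchange_big /=; apply: eq_bigr => t _.
    by rewrite -big_mkcondr /= sum1dep_card.
  by move=> C /two_regular_edges CS; apply: deg_neighbours.
rewrite [RHS]mulnC -sum_nat_const; apply: eq_bigr => C.
rewrite inE => /and3P[_ /forallP d2 _]; rewrite [RHS]mulnC -sum_nat_const.
by apply: eq_bigr => x xS; rewrite (eqP (d2 x)) xS.
Qed.

(** There are two choices for u, and then w is the other neighbour of v and t the
other neighbour of u. *)
Lemma two_regular_path3 S C v : C \in two_regular S -> v \in S ->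
  (\sum_(u in S :\ v) \sum_(w in S :\: [set v; u]) \sum_(t in S :\: [set v; u])
     (path3 w v u t \subset C : nat) = 2)%N.
Proof.
move=> CB vS; transitivity (deg C v); last first.
  by move: CB; rewrite inE => /and3P[_ /forallP/(_ v)/eqP -> _]; rewrite vS.
rewrite (deg_neighbours v (two_regular_edges CB)); apply: eq_bigr => u.
rewrite !inE => /andP[uNv uS].
have pE w t : (path3 w v u t \subset C : nat) =
    (([set v; u] \in C) * (([set v; w] \in C) * ([set u; t] \in C)))%N.
  by rewrite !subUset !sub1set !mulnb andbA.
under eq_bigr => w _ do (under eq_bigr => t _ do rewrite pE; rewrite -!big_distrr /=).
rewrite -big_distrr -big_distrl /=.
have [vuC|] := boolP (_ \in C); last by rewrite mul0n.
by rewrite (other_neighbour CB) // 1?eq_sym // setUC (other_neighbour CB) // setUC.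
Qed.

(** The number of pairs of a graph C and a path of C around an edge v - u, counted
by C on the left.  On the right, the paths with w = t give the second term; the
others are contracted to an oriented edge w - t of a 2-regular graph C' on the
remaining vertices, and C' has twice as many oriented edges as vertices. *)
Lemma card_two_regular_rec S v : v \in S ->
  (2 * #|two_regular S| =
   \sum_(u in S :\ v) (2 * #|S :\: [set v; u]| * #|two_regular (S :\: [set v; u])| +
     \sum_(w in S :\: [set v; u]) #|two_regular (S :\: [set v; u; w])|))%N.
Proof.
move=> vS; rewrite [LHS]mulnC -sum_nat_const.
rewrite -(eq_bigr _ (fun C CB => two_regular_path3 CB vS)) exchange_big /=.
apply: eq_bigr => u; rewrite !inE => /andP[uNv uS].
rewrite -sum_two_regular_edges -big_split exchange_big /=.
apply: eq_bigr => w; rewrite !inE negb_or => /andP[/andP[wNv wNu] wS].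
rewrite exchange_big /= (big_setD1 w) /=; last by rewrite !inE negb_or wNv wNu wS.
rewrite addnC; congr (_ + _)%N.
  apply: eq_bigr => t; rewrite !inE negb_or => /andP[tNw /andP[/andP[tNv tNu] tS]].
  rewrite -card_two_regular_contract // 1?eq_sym //.
  by rewrite -big_mkcondr /= sum1dep_card.
rewrite -card_two_regular_triangle // 1?eq_sym //.
by rewrite -big_mkcondr /= sum1dep_card.
Qed.


(** * Evaluation of the two recursions *)

Lemma card_two_regular_step S n b0 b1 : #|S| = n.+3 ->
  (forall S', #|S'| = n -> #|two_regular S'| = b0) ->
  (forall S', #|S'| = n.+1 -> #|two_regular S'| = b1) ->
  (2 * #|two_regular S| = n.+2 * (n.+1 * (2 * b1 + b0)))%N.
Proof.
move=> cS B0 B1; have [v vS] : exists v, v \in S by apply/card_gt0P; rewrite cS.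
have cSv : #|S :\ v| = n.+2 by move: cS; rewrite (cardsD1 v S) vS => -[].
rewrite (card_two_regular_rec vS) -cSv -sum_nat_const; apply: eq_bigr => u uSv.
have cSvu : #|S :\: [set v; u]| = n.+1.
  by rewrite -setDDl; move: cSv; rewrite (cardsD1 u (S :\ v)) uSv => -[].
rewrite (B1 _ cSvu) cSvu mulnDr mulnA (mulnC n.+1 2%N); congr (_ + _)%N.
rewrite -[X in (X * b0)%N]cSvu -sum_nat_const; apply: eq_bigr => w wSvu; apply: B0.
by rewrite -setDDl; move: cSvu; rewrite (cardsD1 w (S :\: _)) wSvu => -[].
Qed.

(** For S with one or two points the recursion has only zero terms. *)
Lemma card_two_regular_base S :
  (#|S| < 3)%N -> #|two_regular S| = (#|S| == 0)%N.
Proof.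
have [->|[v vS]] := set_0Vmem S.
  rewrite cards0 eqxx => _; apply/eqP/cards1P; exists set0; apply/setP => C.
  rewrite !inE; apply/idP/eqP => [/and3P[CT /forallP d0 _]|->].
    apply/setP => L; rewrite inE; apply/negP => LC.
    have /edgesP[x [y [_ _ _ eL]]] := subsetP CT L LC.
    have := edge_deg_gt0 (C := C) (x := x) (y := y); rewrite -eL LC => /(_ isT).
    by rewrite (eqP (d0 x)) inE.
  apply/and3P; split; first exact: sub0set.
    by apply/forallP => x; rewrite deg0 inE.
  by apply/asboolP => f _ x; rewrite inE.
move=> cS; apply/eqP; rewrite -(eqn_pmul2l (isT : (0 < 2)%N)) (card_two_regular_rec vS).
rewrite (cardsD1 v S) vS muln0 big1 // => u uSv.
have -> : S :\: [set v; u] = set0.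
  apply/eqP; rewrite -cards_eq0 -setDDl.
  by move: cS; rewrite (cardsD1 v S) vS (cardsD1 u (S :\ v)) uSv !ltnS leqn0.
by rewrite cards0 big_set0.
Qed.

(** Three consecutive values b_n, b_(n+1), b_(n+2); the division by 2 is exact for
those numbers since they are cardinals satisfying the recursion. *)
Fixpoint two_regular_numbers n : BinNums.N * BinNums.N * BinNums.N :=
  if n is m.+1 then
    let: (b0, b1, b2) := two_regular_numbers m in
    let b3 := N.div (N.of_nat m.+2 * (N.of_nat m.+1 * (2 * b1 + b0))) 2 in
    (b1, b2, b3)
  else (1%num, 0%num, 0%num).

Definition two_regular_number n := (two_regular_numbers n).1.1.

Lemma card_two_regular S : #|two_regular S| = N.to_nat (two_regular_number #|S|).
Proof.
rewrite /two_regular_number; move: {2}#|S| (erefl #|S|) => n.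
pose counts k (b : BinNums.N) :=
  forall S', #|S'| = k -> #|two_regular S'| = N.to_nat b.
(* The recursion has depth three, so three consecutive values are carried. *)
suff: [/\ counts n (two_regular_numbers n).1.1,
          counts n.+1 (two_regular_numbers n).1.2 &
          counts n.+2 (two_regular_numbers n).2].
  by move=> [Bn _ _] cS; rewrite cS; apply: Bn.
elim: n {S} => [|n]; first by split=> S' cS'; rewrite card_two_regular_base cS'.
rewrite [two_regular_numbers n.+1]/=.
case: two_regular_numbers => [[b0 b1] b2] /= [B0 B1 B2]; split=> // S' cS'.
have := card_two_regular_step cS' B0 B1; set b := #|_| => e.
have -> : (N.of_nat n.+2 * (N.of_nat n.+1 * (2 * b1 + b0)) = N.of_nat b * 2)%num.
  move: e; lia.
by rewrite N.div_mul // Nat2N.id.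
Qed.

Definition leaf_term (a : Z) n k : Z :=
  ((-1) ^+ k * ('C(n, k)%:R * ((n - k)%N%:R ^+ k * a)))%R.

(** The list a_(n-1), ..., a_0, each obtained by solving the alternating identity
for its term of index 0. *)
Fixpoint nonsingular_numbers n : seq Z :=
  if n is m.+1 then
    let s := nonsingular_numbers m in
    (Z.of_N (two_regular_number m) -
       foldr (fun k acc => leaf_term s`_k m k.+1 + acc) 0 (iota 0 m))%R :: s
  else [::].

Definition nonsingular_number n : Z := (nonsingular_numbers n.+1)`_0.

Lemma nth_nonsingular_numbers n k : (k < n)%N ->
  (nonsingular_numbers n)`_k = nonsingular_number (n - k.+1).
Proof.
elim: n k => // n IHn [|k] kn; first by rewrite subn1.
by rewrite [LHS]/= IHn.
Qed.

Lemma nonsingular_number_rec n :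
  \sum_(k < n.+1) leaf_term (nonsingular_number (n - k)%N) n k =
  Z.of_N (two_regular_number n).
Proof.
rewrite big_ord_recl /leaf_term expr0 bin0 expr0 !mul1r subn0.
rewrite [nonsingular_number n]/= -[X in _ = X]addr0 -addrA; congr (_ + _).
apply/eqP; rewrite addrC subr_eq0; apply/eqP.
transitivity (\sum_(0 <= k < n) leaf_term (nonsingular_numbers n)`_k n k.+1);
  last first.
  by rewrite unlock /reducebig /index_iota subn0.
rewrite big_mkord; apply: eq_bigr => k _.
by rewrite /leaf_term nth_nonsingular_numbers.
Qed.

Lemma sum_subsets_card (K : comPzRingType) S (g : nat -> K) :
  \sum_(U : {set T} | U \subset S) g #|U| = \sum_(k < #|S|.+1) 'C(#|S|, k)%:R * g k.
Proof.
rewrite (partition_big (fun U : {set T} => inord #|U| : 'I_#|S|.+1) xpredT) //=.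
apply: eq_bigr => k _; rewrite -cards_draws mulr_natl -sumr_const.
apply: eq_big => [U|U /andP[US /eqP <-]]; last by rewrite inordK ?ltnS ?subset_leq_card.
rewrite inE; apply: andb_id2l => US.
by rewrite -val_eqE /= inordK // ltnS subset_leq_card.
Qed.

Lemma card_nonsingular S : #|nonsingular S|%:R = nonsingular_number #|S|.
Proof.
have [n] := ubnP #|S|; elim: n S => // n IHn S leSn.
have cD U : U \subset S -> #|S :\: U| = (#|S| - #|U|)%N.
  by move=> US; rewrite cardsD (setIidPr US).
pose g k : Z := (-1) ^+ k *
  ((#|S| - k)%N%:R ^+ k * nonsingular_number (#|S| - k)%N).
have := leaf_inclusion_exclusion Z S; have := nonsingular_number_rec #|S|.
under eq_bigr => k _ do rewrite /leaf_term mulrCA -/(g k).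
rewrite -(sum_subsets_card S g).
(* By induction the two alternating sums have the same terms, except possibly
   the terms for U empty, which are the two sides of the goal. *)
rewrite (bigD1 set0) ?sub0set //= => eN; rewrite (bigD1 set0) ?sub0set //=.
rewrite (eq_bigr (fun U : {set T} => g #|U|)); last first.
  move=> U /andP[US U0]; rewrite /g natrM natrX IHn cD // -ltnS.
  apply: leq_trans leSn.
  by rewrite ltnS ltn_subrL !card_gt0 U0 (subset_neq0 US).
have -> : #|two_regular S|%:R = Z.of_N (two_regular_number #|S|) :> Z.
  by rewrite card_two_regular natrZ N_nat_Z.
rewrite -eN => /addIr; rewrite /g cards0 !expr0 setD0 subn0 !mul1r mul1n.
by [].
Qed.

End Graphs.

(** * Numerals and lines *)

Lemma nonsingular_number16 :
  nonsingular_number 16 = Z.of_N 984014621487058560%num.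
Proof. by vm_compute. Qed.

(** The decimal numeral of the statement denotes a unary number that is too large to
be built; its digits are read in binary instead. *)
Fixpoint N_of_digits (d : Decimal.uint) (acc : N) : N :=
  (match d with
  | Decimal.Nil => acc
  | Decimal.D0 d' => N_of_digits d' (10 * acc)
  | Decimal.D1 d' => N_of_digits d' (10 * acc + 1)
  | Decimal.D2 d' => N_of_digits d' (10 * acc + 2)
  | Decimal.D3 d' => N_of_digits d' (10 * acc + 3)
  | Decimal.D4 d' => N_of_digits d' (10 * acc + 4)
  | Decimal.D5 d' => N_of_digits d' (10 * acc + 5)
  | Decimal.D6 d' => N_of_digits d' (10 * acc + 6)
  | Decimal.D7 d' => N_of_digits d' (10 * acc + 7)
  | Decimal.D8 d' => N_of_digits d' (10 * acc + 8)
  | Decimal.D9 d' => N_of_digits d' (10 * acc + 9)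
  end)%num.

Lemma of_uint_accE d acc :
  Nat.of_uint_acc d acc = N.to_nat (N_of_digits d (N.of_nat acc)).
Proof.
elim: d acc => [acc|d IHd acc|d IHd acc|d IHd acc|d IHd acc|d IHd acc|
  d IHd acc|d IHd acc|d IHd acc|d IHd acc|d IHd acc] /=; first by rewrite Nat2N.id.
all: rewrite IHd Nat.tail_mul_spec; congr (N.to_nat (N_of_digits d _)); lia.
Qed.

Lemma numeralE d : Nat.of_num_uint (Number.UIntDecimal d) = N.to_nat (N_of_digits d 0).
Proof. exact: of_uint_accE. Qed.

Lemma linesE : lines = edges [set: point].
Proof.
apply/setP => L; apply/imset2P/edgesP => [[x v _ v0 ->]|[x [y [_ _ xNy ->]]]].
  exists x, (x + v)%R; split=> //.
  by apply: contraTneq v0 => e; rewrite inE negbK -[v](addKr x) -e addNr.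
exists x (y - x)%R; rewrite ?inE ?subr_eq0 1?eq_sym //.
by rewrite addrC subrK.
Qed.

Lemma admissibleE (R : realType) (C : {set {set point}}) :
  `[< admissible R C >] = determined R[i] setT C.
Proof.
apply/asboolP/asboolP => [inj f fC x _|det f g /ffunP fg].
  have /ffunP/(_ x) : finfun f = 0%R; last by rewrite !ffunE.
  apply: inj; apply/ffunP => L; rewrite raddf0 !ffunE /radon -[RHS](fC _ (valP L)).
  by apply: eq_bigr => y _; rewrite ffunE.
apply/ffunP => x; apply/eqP; rewrite -subr_eq0.
rewrite (det (fun x => f x - g x)%R) ?inE // => L LC.
have := fg (exist _ L LC); rewrite !ffunE /radon /= sumrB => ->; exact: subrr.
Qed.

Lemma card_point : #|[set: point]| = 16.
Proof. by rewrite cardsT card_mx card_ord. Qed.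

Theorem theorem1p6 (R : realType) :
  #|[set C : {set {set point}} |
      [&& line_complex C, `[< admissible R C >] & #|C| == 16]]|
    = 984014621487058560.
Proof.
transitivity #|nonsingular R[i] [set: point]|.
  apply: eq_card => C; rewrite !inE /line_complex linesE admissibleE card_point.
  by congr (_ && _); apply: andbC.
apply: Nat2Z.inj; rewrite numeralE N_nat_Z -natrZ.
by rewrite card_nonsingular card_point nonsingular_number16.
Qed.
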